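(* Let $k>2$ be an integer and let $p\in\{1,2,3\}$. Then for every positive integer $n$, $t_p(n,K_k)=e_p(T(n,k))$, where $T(n,k)$ is the Tur\'an graph.
   Context: All graphs are finite, undirected, without loops or multiple edges. For a graph $G$ with degree sequence $d_1,\ldots,d_n$ and a positive integer $p$, $e_p(G)=\sum_{i=1}^n d_i^p$. For a fixed graph $H$, $t_p(n,H)$ denotes the maximum of $e_p(G)$ over all graphs $G$ with $n$ vertices that do not contain $H$ as a subgraph. $K_k$ is the complete graph on $k$ vertices. The Tur\'an graph $T(n,k)$ is the complete $(k-1)$-partite graph on $n$ vertices whose $k-1$ vertex classes have sizes as equal as possible (any two class sizes differ by at most one); it is the extremal graph for the Tur\'an number of $K_k$. *)

(* Defs.v *)
From HB Require Import structures.
From mathcomp Require Import all_boot.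

Set Implicit Arguments.
Unset Strict Implicit.
Unset Printing Implicit Defensive.

(* The adjacency relation is stored as a set of ordered pairs, so that the     *)
(* graphs on a fixed finite vertex type themselves form a finType.             *)
Definition sgraph_axiom (V : finType) (E : {set V * V}) : bool :=
  [forall x, (x, x) \notin E] &&
  [forall x, forall y, ((x, y) \in E) == ((y, x) \in E)].

Record sgraph (V : finType) := SGraph {
  arcs : {set V * V};
  arcsP : sgraph_axiom arcs
}.

HB.instance Definition _ (V : finType) := [isSub for @arcs V].
HB.instance Definition _ (V : finType) := [Finite of sgraph V by <:].

Definition adj (V : finType) (G : sgraph V) : rel V :=
  fun x y => (x, y) \in arcs G.

Definition degree (V : finType) (G : sgraph V) (x : V) : nat :=
  #|[set y | adj G x y]|.

Definition e_ (p : nat) (V : finType) (G : sgraph V) : nat :=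
  \sum_(x : V) degree G x ^ p.

(* Containment as a not necessarily induced subgraph. *)
Definition has_subgraph (U V : finType) (H : sgraph U) (G : sgraph V) : bool :=
  [exists f : {ffun U -> V},
    injectiveb f && [forall x, forall y, adj H x y ==> adj G (f x) (f y)]].

(* \max over an empty range is 0: this is only relevant when every graph on n  *)
(* vertices contains H, which cannot happen if H has an edge.                  *)
Definition t_ (p n : nat) (U : finType) (H : sgraph U) : nat :=
  \max_(G : sgraph 'I_n | ~~ has_subgraph H G) e_ p G.

Lemma multipartite_proof (V C : finType) (c : V -> C) :
  sgraph_axiom [set u : V * V | c u.1 != c u.2].
Proof.
apply/andP; split; apply/forallP => x; first by rewrite inE /= eqxx.
by apply/forallP => y; rewrite !inE /= (eq_sym (c x)).
Qed.

(* The complete multipartite graph whose classes are the fibres of c. *)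
Definition multipartite (V C : finType) (c : V -> C) : sgraph V :=
  SGraph (multipartite_proof c).

Definition complete_graph (k : nat) : sgraph 'I_k := multipartite (@id 'I_k).

(* G is T(n, k), which has k - 1 classes (and not k); a class may be empty,    *)
(* which happens exactly when n < k - 1.                                       *)
Definition is_turan_graph (n k : nat) (G : sgraph 'I_n) : Prop :=
  exists c : 'I_n -> 'I_k.-1,
    G = multipartite c /\
    forall i j : 'I_k.-1,
      #|[set x | c x == i]| <= #|[set x | c x == j]|.+1.

Lemma adj_complete_graph (k : nat) (x y : 'I_k) :
  adj (complete_graph k) x y = (x != y).
Proof. by rewrite /adj inE. Qed.

Lemma card_residue_class (n m r : nat) : r < m ->
  #|[set x : 'I_n | x %% m == r]| = n %/ m + (r < n %% m).
Proof.
move=> lt_rm; have m_gt0 : 0 < m by apply: leq_trans lt_rm.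
rewrite -sum1dep_card big_mkcond /=.
elim: n => [|n IHn]; first by rewrite big_ord0 div0n mod0n.
rewrite big_ord_recr /= IHn divnS // modnS.
have lt_nm := ltn_pmod n m_gt0.
have -> : (if n %% m == r then 1 else 0) = (n %% m == r) by case: eqP.
case: ifPn => [dvd_m | ndvd_m]; rewrite ?add0n -addnA ?ltn0 ?addn0.
  have n_eq : (n %% m).+1 = m.
    apply/eqP; rewrite eqn_leq lt_nm /=; apply: dvdn_leq => //.
    by move: dvd_m; rewrite /dvdn -addn1 -modnDml addn1.
  rewrite -[in RHS]addnC; congr (_ + _).
  by move: lt_rm; rewrite -{1}n_eq ltnS leq_eqVlt eq_sym; case: ltngtP.
by congr (_ + _); rewrite ltnS; case: ltngtP.
Qed.

Lemma turan_graph_exists (n k : nat) :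
  2 < k -> exists G : sgraph 'I_n, is_turan_graph k G.
Proof.
case: k => [|[|m]] // _.
pose c (x : 'I_n) : 'I_m.+1 := Ordinal (ltn_pmod x (ltn0Sn m)).
exists (multipartite c), c; split => // i j.
have cE l : [set x | c x == l] = [set x : 'I_n | x %% m.+1 == l].
  by apply/setP => x; rewrite !inE -val_eqE.
rewrite !cE !card_residue_class //= -addnS leq_add2l.
by case: (i < _).
Qed.

(* Main.v *)
Require Import Defs.
From mathcomp Require Import all_boot zify ring.

Set Implicit Arguments.
Unset Strict Implicit.
Unset Printing Implicit Defensive.

(** By Erdős' degree majorization theorem, a graph without a clique on [m + 1]
    vertices has a complete [m]-partite graph on the same vertices all of whose
    degrees are at least as large: put the non-neighbours of a vertex of maximum
    degree into one class and recurse on its neighbourhood.  It remains to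
    maximize the sum of [s_i * (n - s_i) ^ p] over class sizes with sum [n].
    Write two of the sizes as [h + d] and [h - d], so [2 h <= n].  Their joint
    contribution is an even polynomial in [d], and for [p <= 3] it is strictly
    decreasing in [d ^ 2]; for [p = 3] its non-constant part is
    [- 6 (n - h) (n - 2 h) d ^ 2 - 2 d ^ 4].  Hence only balanced sizes are
    optimal. *)

(** * Class sizes and degrees in complete multipartite graphs *)

Definition class_size (V C : finType) (c : V -> C) (i : C) : nat :=
  #|[set x | c x == i]|.

Lemma sum_class_size (V C : finType) (c : V -> C) :
  \sum_i class_size c i = #|V|.
Proof.
rewrite -sum1_card (partition_big c xpredT) //=.
by apply: eq_bigr => i _; rewrite sum1dep_card.
Qed.

Lemma class_size_pair (V C : finType) (c : V -> C) (i j : C) :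
  i != j -> class_size c i + class_size c j <= #|V|.
Proof.
move=> neq_ij; rewrite -(sum_class_size c) (bigD1 i) //= (bigD1 j) 1?eq_sym //=.
by rewrite addnA leq_addr.
Qed.

Lemma degree_multipartite (V C : finType) (c : V -> C) (x : V) :
  degree (multipartite c) x = #|V| - class_size c (c x).
Proof.
rewrite /degree /class_size -(cardsC [set y | c y == c x]) addKn; apply: eq_card => y.
by rewrite !inE /adj inE /= eq_sym.
Qed.

Lemma e_multipartite (p : nat) (V C : finType) (c : V -> C) :
  e_ p (multipartite c) =
  \sum_i class_size c i * (#|V| - class_size c i) ^ p.
Proof.
rewrite /e_ (partition_big c xpredT) //=; apply: eq_bigr => i _.
under eq_bigr => x /eqP cx do rewrite degree_multipartite cx.
by rewrite sum_nat_cond_const.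
Qed.

(** * Balanced class sizes and their optimality *)

(** Balance leaves only the values [q] and [q + 1], and Euclidean division fixes how often each
    occurs. So two balanced families with the same index type and total give the same sum. *)
Lemma balanced_sum (I : finType) (s : I -> nat) (f : nat -> nat) :
  (forall i j, s i <= (s j).+1) ->
  let n := \sum_i s i in
  \sum_i f (s i) =
  (#|I| - n %% #|I|) * f (n %/ #|I|) + (n %% #|I|) * f (n %/ #|I|).+1.
Proof.
(* For empty [I] the total [n] is [0], so both coefficients vanish. *)
move=> bal n; have [i0 _|I0] := pickP (@predT I); last first.
  have I0' : #|I| = 0 by apply: eq_card0.
  by rewrite /n !big_pred0 // I0' modn0.
case: (arg_minnP s (erefl (predT i0))) => i1 _ min1.
pose q := s i1; pose B := [set i | s i != q].
have sE i : s i = q + (i \in B).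
  rewrite inE; have := min1 i isT; have := bal i i1; rewrite -/q.
  by case: eqP => /= ?; lia.
(* A minimal class lies outside [B], so [#|B|] is a genuine remainder modulo [#|I|]. *)
have cardB : #|B| < #|I|.
  rewrite -cardsT; apply: proper_card; apply/properP; split.
    exact: subsetT.
  by exists i1; rewrite ?inE ?eqxx.
have nE : n = q * #|I| + #|B|.
  rewrite /n (eq_bigr (fun i => q + (i \in B))) // big_split /= sum_nat_const mulnC.
  congr (_ + _); rewrite -sum1_card [RHS]big_mkcond.
  by apply: eq_bigr => i _; case: (i \in B).
have -> : n %/ #|I| = q by rewrite nE divnMDl ?divn_small ?addn0; lia.
have -> : n %% #|I| = #|B| by rewrite nE modnMDl modn_small.
rewrite (bigID (mem B)) /= addnC; congr (_ + _).
  under eq_bigr => i /negbTE iB do rewrite sE iB addn0.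
  rewrite sum_nat_cond_const; congr (_ * _).
  by rewrite -(cardsC B) addKn; apply: eq_card => i; rewrite !inE.
under eq_bigr => i iB do rewrite sE iB addn1.
by rewrite sum_nat_const.
Qed.

Definition recolor (V C : finType) (c : V -> C) (x : V) (j : C) : V -> C :=
  fun y => if y == x then j else c y.

Lemma class_size_recolor (V C : finType) (c : V -> C) (x : V) (j i : C) :
  j != c x ->
  class_size (recolor c x j) i =
  if i == c x then (class_size c i).-1
  else if i == j then (class_size c i).+1 else class_size c i.
Proof.
rewrite /class_size /recolor => neq_j; case: eqVneq => [->|neq_i].
  rewrite [in RHS](cardsD1 x) inE eqxx /=; apply: eq_card => y.
  by rewrite !inE; case: (eqVneq y x) => // _; rewrite (negbTE neq_j).
case: eqVneq => [->|neq_ij].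
  rewrite [LHS](cardsD1 x) inE eqxx eqxx add1n; congr _.+1.
  apply: eq_card => y; rewrite !inE; case: (eqVneq y x) => [->|//].
  by rewrite eq_sym (negbTE neq_j).
apply: eq_card => y; rewrite !inE; case: (eqVneq y x) => // ->.
by rewrite eq_sym (negbTE neq_ij) eq_sym (negbTE neq_i).
Qed.

(** The first hypothesis makes moving a vertex between classes whose sizes differ by at least two a
    strict gain. A maximizer is therefore balanced, and [balanced_sum] gives it the value of
    [c0]. *)
Lemma balanced_max (V C : finType) (f : nat -> nat) (c0 c : V -> C) :
  (forall a b, b.+1 < a -> a + b <= #|V| -> f a + f b < f a.-1 + f b.+1) ->
  (forall i j, class_size c0 i <= (class_size c0 j).+1) ->
  \sum_i f (class_size c i) <= \sum_i f (class_size c0 i).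
Proof.
move=> move_lt bal0.
pose F (d : {ffun V -> C}) := \sum_i f (class_size d i).
case: (arg_maxnP F (erefl (predT (finfun c)))) => d _ maxd.
have classE (g : V -> C) i : class_size (finfun g) i = class_size g i.
  by apply: eq_card => y; rewrite !inE ffunE.
have bald i j : class_size d i <= (class_size d j).+1.
  rewrite leqNgt; apply/negP => lt_ji.
  have neq_ij : j != i by apply/eqP => eq_ji; move: lt_ji; rewrite eq_ji; lia.
  have /card_gt0P[x] : 0 < class_size d i by lia.
  rewrite inE => /eqP dx; rewrite -dx in neq_ij lt_ji.
  have := maxd (finfun (recolor d x j)) isT; apply/negP; rewrite -ltnNge.
  have -> : F (finfun (recolor d x j)) = \sum_l f (class_size (recolor d x j) l).
    by apply: eq_bigr => l _; rewrite classE.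
  (* Only the classes [d x] and [j] change size; all other terms cancel. *)
  rewrite /F (bigD1 (d x)) //= (bigD1 j) //=.
  rewrite [ltnRHS](bigD1 (d x)) //= [X in _ < _ + X](bigD1 j) //=.
  rewrite !class_size_recolor // !eqxx (negbTE neq_ij) !addnA.
  under [X in _ < _ + X]eq_bigr => l /andP[/negbTE neq_l /negbTE neq_lj].
    by rewrite class_size_recolor // neq_l neq_lj; over.
  rewrite ltn_add2r.
  by apply: move_lt => //; apply: class_size_pair; rewrite eq_sym.
have <- : F d = \sum_i f (class_size c0 i).
  by rewrite /F (balanced_sum _ bald) (balanced_sum _ bal0) !sum_class_size.
have -> : \sum_i f (class_size c i) = F (finfun c).
  by apply: eq_bigr => i _; rewrite classE.
exact: maxd.
Qed.

Lemma transfer_lt (p n a b : nat) : p \in [:: 1; 2; 3] ->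
  b.+1 < a -> a + b <= n ->
  a * (n - a) ^ p + b * (n - b) ^ p <
  a.-1 * (n - a.-1) ^ p + b.+1 * (n - b.+1) ^ p.
Proof.
move=> hp lt_ba le_n.
(* Writing [a = b + t + 2] and [n = a + b + r] removes truncated subtraction and leaves polynomial
   identities. *)
have [t def_a] : exists t, a = (b + t).+2 by exists (a - b.+2); lia.
have [r ->] : exists r, n = (b + t).+2 + b + r by exists (n - a - b); lia.
rewrite def_a.
have -> : (b + t).+2 + b + r - (b + t).+2 = b + r by lia.
have -> : (b + t).+2 + b + r - b = (b + t).+2 + r by lia.
have -> : (b + t).+2 + b + r - (b + t).+2.-1 = b.+1 + r by lia.
have -> : (b + t).+2 + b + r - b.+1 = (b + t).+1 + r by lia.
(* The gain is the drop [t + 1] of [d ^ 2] times a positive cofactor. *)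
rewrite -subn_gt0 /=.
set L := _ + b * _; set M := _ + b.+1 * _.
suff [g ->] : exists g, M = L + (t + 1) * g.+1 by rewrite addKn; lia.
rewrite /L /M {L M}; move: hp; rewrite !inE => /or3P[] /eqP->.
- by exists 1; ring.
- by exists ((b + t).+1 + b + 4 * r); ring.
(* With [n - 2 h = r] and [d = t / 2 + 1], the cofactor is
   [6 (n - h) r + 2 (d ^ 2 + (d - 1) ^ 2)]. *)
- exists (3 * r * (2 * b + t + 2 + 2 * r) + t ^ 2 + 2 * t + 1); ring.
Qed.

(** * Cliques and degree majorization *)

Definition clique (V : finType) (G : sgraph V) (Q : {set V}) : Prop :=
  {in Q &, forall x y, x != y -> adj G x y}.

Lemma adj_sym (V : finType) (G : sgraph V) (x y : V) : adj G x y = adj G y x.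
Proof. by case/andP: (arcsP G) => _ /forallP/(_ x)/forallP/(_ y)/eqP. Qed.

Lemma adj_irrefl (V : finType) (G : sgraph V) (x : V) : adj G x x = false.
Proof. by case/andP: (arcsP G) => /forallP/(_ x)/negbTE. Qed.

Lemma clique_has_complete (V : finType) (G : sgraph V) (Q : {set V}) (k : nat) :
  clique G Q -> #|Q| = k -> has_subgraph (complete_graph k) G.
Proof.
move=> clQ <-; apply/existsP; exists [ffun i => enum_val i].
apply/andP; split.
  by apply/injectiveP => i j; rewrite !ffunE => /enum_val_inj.
apply/forallP => i; apply/forallP => j; apply/implyP.
rewrite adj_complete_graph !ffunE => neq_ij.
by apply: clQ; rewrite ?enum_valP // (inj_eq enum_val_inj).
Qed.

(** Degrees are counted inside [A] so that the induction can pass to a neighbourhood; colours are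
    naturals so that [m] is fresh for the new class. *)
Lemma degree_majorization (V : finType) (G : sgraph V) (m : nat) (A : {set V}) :
  (forall Q : {set V}, Q \subset A -> clique G Q -> #|Q| != m.+1) ->
  exists c : V -> nat, {in A, forall x, c x < m /\
    #|[set y in A | adj G x y]| <= #|[set y in A | c y != c x]|}.
Proof.
elim: m A => [|m IHm] A freeA.
  exists (fun=> 0) => x xA; have := freeA [set x]; rewrite cards1 sub1set xA.
  suff clx : clique G [set x] by move=> /(_ isT clx).
  by move=> y z; rewrite !inE => /eqP-> /eqP->; rewrite eqxx.
have [->|[x0 x0A]] := set_0Vmem A; first by exists (fun=> 0) => x; rewrite inE.
pose N x := [set y in A | adj G x y].
case: (arg_maxnP (fun x => #|N x|) x0A) => x /= xA maxx; pose B := N x.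
have {}xA : x \in A by [].
have sBA : B \subset A by apply/subsetP => y; rewrite inE => /andP[].
(* A clique in [B] stays a clique when [x] is added, so [B] inherits the bound lowered by one. *)
have [Q sQB clQ|c cP] := IHm B.
  have xQ : x \notin Q.
    by apply: contra (subsetP sQB x) _; rewrite inE adj_irrefl andbF.
  have := freeA (x |: Q); rewrite cardsU1 xQ add1n eqSS; apply.
    by rewrite subUset sub1set xA (subset_trans sQB).
  have adjx y : y \in Q -> adj G x y by move/(subsetP sQB); rewrite inE => /andP[].
  move=> y z; rewrite !in_setU1 => /orP[/eqP->|yQ] /orP[/eqP->|zQ].
  - by rewrite eqxx.
  - by move=> _; apply: adjx.
  - by move=> _; rewrite adj_sym; apply: adjx.
  - exact: clQ.
exists (fun y => if y \in B then c y else m) => y yA.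
case: ifPn => [yB|yB]; last first.
  (* A vertex outside [B] becomes adjacent to all of [B], whose size is the maximum degree. *)
  split=> //; apply: leq_trans (maxx y yA) _; apply: subset_leq_card.
  apply/subsetP => z zB; rewrite inE (subsetP sBA) //= zB.
  by have [/ltn_eqF->] := cP z zB.
have [lt_cy le_deg] := cP y yB; split; first exact: leqW.
(* For [y] in [B], induction handles the neighbours inside [B]; every vertex of [A] outside [B] has
   a colour different from that of [y]. *)
rewrite -(cardsID B) -[leqRHS](cardsID B); apply: leq_add.
  have -> : [set z in A | adj G y z] :&: B = [set z in B | adj G y z].
    apply/setP => z; rewrite in_setI !(in_set, inE) andbC.
    by case zA: (z \in A); rewrite ?andbF.
  apply: leq_trans le_deg _; apply: subset_leq_card; apply/subsetP => z.
  rewrite in_setI [z \in [set _ in B | _]]inE => /andP[zB neq].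
  by rewrite zB andbT inE (subsetP sBA) //= zB.
apply: subset_leq_card; apply/subsetP => z; rewrite !in_setD => /andP[zB].
rewrite zB [z \in _]inE => /andP[zA _]; rewrite inE zA (negbTE zB) /=.
by rewrite eq_sym (ltn_eqF lt_cy).
Qed.

Lemma complete_free_majorized (V : finType) (G : sgraph V) (m : nat) :
  ~~ has_subgraph (complete_graph m.+2) G ->
  exists c : V -> 'I_m.+1, forall x, degree G x <= degree (multipartite c) x.
Proof.
move=> freeG; have [Q _ clQ|c cP] := @degree_majorization V G m.+1 setT.
  by apply: contra freeG => /eqP; apply: clique_has_complete.
exists (fun x => inord (c x)) => x; have [lt_cx] := cP x (in_setT x).
rewrite /degree; congr (_ <= _); apply: eq_card => y; rewrite !inE //.
rewrite /adj inE /= -val_eqE /= !inordK //; first by rewrite eq_sym.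
by have [] := cP y (in_setT y).
Qed.

(** By pigeonhole, two vertices of a complete subgraph would share a class. *)
Lemma multipartite_complete_free (V C : finType) (c : V -> C) (k : nat) :
  #|C| < k -> ~~ has_subgraph (complete_graph k) (multipartite c).
Proof.
move=> lt_k; apply/existsP => -[f /andP[_ /forallP fP]].
suff /leq_card : injective (c \o f) by rewrite card_ord leqNgt lt_k.
move=> i j /= eq_c; apply/eqP/negPn/negP => neq_ij.
have /forallP/(_ j)/implyP := fP i.
by rewrite adj_complete_graph neq_ij /adj inE /= eq_c eqxx => /(_ isT).
Qed.

Theorem theorem1p1 (k p n : nat) (hk : 2 < k) (hp : p \in [:: 1; 2; 3])
    (hn : 0 < n) (T : sgraph 'I_n) (hT : is_turan_graph k T) :
  t_ p n (complete_graph k) = e_ p T.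
Proof.
case: k hk hT => [|[|m]] // _ [c0 [-> bal0]].
apply/eqP; rewrite eqn_leq; apply/andP; split.
  apply/bigmax_leqP => G /complete_free_majorized[c cP].
  apply: (@leq_trans (e_ p (multipartite c))).
    apply: leq_sum => x _; rewrite leq_exp2r //.
    by move: hp; rewrite !inE => /or3P[] /eqP->.
  rewrite !e_multipartite.
  apply: (@balanced_max _ _ (fun s => s * (#|'I_n| - s) ^ p)) => //.
  by move=> a b; apply: transfer_lt.
apply: (@leq_bigmax_cond _ _ (fun G => e_ p G)).
by apply: multipartite_complete_free; rewrite card_ord.
Qed.
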